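(* Let $\mathcal{L}=\mathfrak{sl}_n\dot+\mathcal{I}$ (with $n\ge2$) be a simple complex Leibniz algebra with $\mathcal{I}\neq\{0\}$, as described in the context. Then a linear map $\Delta:\mathcal{L}\to\mathcal{L}$ is a local automorphism if and only if $\Delta$ is an automorphism of $\mathcal{L}$.
   Context: A (right) Leibniz algebra is a vector space $\mathcal{L}$ with a bilinear bracket satisfying $[x,[y,z]]=[[x,y],z]-[[x,z],y]$ for all $x,y,z$. Its ideal of squares is $\mathcal{I}=\mathrm{span}\{[x,x]:x\in\mathcal{L}\}$; $\mathcal{L}$ is simple if $\mathcal{L}/\mathcal{I}$ is a simple Lie algebra and $\mathcal{I}$ is the only nontrivial proper ideal of $\mathcal{L}$. Here $\mathcal{L}=\mathfrak{sl}_n\oplus\mathcal{I}$ as vector spaces, where $\mathfrak{sl}_n$ is the Lie algebra of trace-zero complex $n\times n$ matrices and $\mathcal{I}$ is a nonzero irreducible finite-dimensional right $\mathfrak{sl}_n$-module (action $v\mapsto [v,g]$) on which $\mathfrak{sl}_n$ acts nontrivially, and the bracket is $[(g_1,v_1),(g_2,v_2)]=([g_1,g_2],[v_1,g_2])$. An automorphism of $\mathcal{L}$ is an invertible linear map $\Phi$ with $\Phi([x,y])=[\Phi(x),\Phi(y)]$ for all $x,y$. A linear map $\Delta:\mathcal{L}\to\mathcal{L}$ is a local automorphism if for every $x\in\mathcal{L}$ there is an automorphism $\Phi_x$ of $\mathcal{L}$ with $\Phi_x(x)=\Delta(x)$. *)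

(* Defs.v *)
From HB Require Import structures.
From mathcomp Require Import all_boot all_order all_algebra.
Set Implicit Arguments. Unset Strict Implicit. Unset Printing Implicit Defensive.
Import GRing.Theory Num.Theory.
Local Open Scope ring_scope.

Section SlDef.
Variables (F : fieldType) (n : nat).

Definition trace0 : {pred 'M[F]_n} := [pred A | \tr A == 0].

Lemma trace0_submod : submod_closed trace0.
Proof.
split; first by rewrite inE mxtrace0.
move=> a u v; rewrite !inE => /eqP hu /eqP hv.
by rewrite mxtraceD mxtraceZ hu hv mulr0 addr0.
Qed.

HB.instance Definition _ := GRing.isSubmodClosed.Build F 'M[F]_n trace0 trace0_submod.

Record sl := SL { slval :> 'M[F]_n; slvalP : slval \in trace0 }.
HB.instance Definition _ := [isSub for slval].
HB.instance Definition _ := [Choice of sl by <:].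
HB.instance Definition _ := [SubChoice_isSubLmodule of sl by <:].

Lemma trace0_commutator (A B : sl) : (A *m B - B *m A) \in trace0.
Proof. by rewrite inE raddfB /= mxtrace_mulC subrr. Qed.

Definition sl_bracket (A B : sl) : sl := SL (trace0_commutator A B).

End SlDef.

Section Leibniz.
Variables (F : fieldType) (n d : nat).

(** The Leibniz algebra L = sl_n (+) I, where I = 'rV_d (row vectors) with the
    right action v |-> [v, g] := v *m rho g. *)
Definition Lalg := (sl F n * 'rV[F]_d)%type.

Variable rho : sl F n -> 'M[F]_d.

Definition Lbracket (x y : Lalg) : Lalg :=
  (sl_bracket x.1 y.1, x.2 *m rho y.1).

(** rho defines a right sl_n-module structure on 'rV_d:
    linearity and  [v,[g,h]] = [[v,g],h] - [[v,h],g]. *)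
Definition right_module : Prop :=
  linear rho /\
  forall g h : sl F n, rho (sl_bracket g h) = rho g *m rho h - rho h *m rho g.

Definition irreducible_module : Prop :=
  (0 < d)%N /\
  forall U : 'M[F]_d, (forall g : sl F n, (U *m rho g <= U)%MS) ->
    U = 0 \/ row_full U.

Definition nontrivial_action : Prop := exists g : sl F n, rho g != 0.

Definition is_automorphism (f : Lalg -> Lalg) : Prop :=
  [/\ linear f, bijective f & forall x y, f (Lbracket x y) = Lbracket (f x) (f y)].

Definition is_local_automorphism (D : Lalg -> Lalg) : Prop :=
  linear D /\
  forall x, exists Phi : Lalg -> Lalg, is_automorphism Phi /\ Phi x = D x.

End Leibniz.

(* Main.v *)
(** An automorphism of L preserves the ideal I, hence has the form
    (g, v) |-> (a g, m g + i v) where a is an automorphism of sl_n and m, i are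
    equivariant along a; let (phi, theta, psi) be the components of Delta.
    If v is an eigenvector of h in I, locality at (h, v) shows that psi v is an
    eigenvector of phi h for the same eigenvalue: immediately when Hom(sl_n, I) = 0,
    since then m = 0; otherwise I is the adjoint module, all components are
    multiples of a by Schur's lemma, and locality at both (g, h) and (h, g), for
    g an eigenvector of ad h, gives the claim.  Tripotent elements h act
    diagonalizably on I and span sl_n, so psi intertwines the actions of h and
    phi h for all h; as I is faithful, phi preserves brackets. *)
Require Import Defs.
From HB Require Import structures.
From mathcomp Require Import all_boot all_order all_algebra.
From Stdlib Require Import Classical.
Import GRing.Theory Num.Theory.
Local Open Scope ring_scope.

(** * Matrix units, simplicity and tripotent elements of sl_n *)

Section SpecialLinear.
Context {F : numFieldType} {n : nat}.
Implicit Types (A B : 'M[F]_n) (g h : sl F n).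

Lemma sl_inj g h : slval g = slval h -> g = h.
Proof. exact: val_inj. Qed.

Lemma slvalD g h : slval (g + h) = slval g + slval h.
Proof. exact: (raddfD (val : sl F n -> 'M_n)). Qed.

Lemma slvalN g : slval (- g) = - slval g.
Proof. exact: (raddfN (val : sl F n -> 'M_n)). Qed.

Lemma slvalZ a g : slval (a *: g) = a *: slval g.
Proof. exact: (linearZ_LR (val : {linear sl F n -> 'M[F]_n})). Qed.

Lemma sl_bracketE g h : slval (sl_bracket g h) = g *m h - h *m g.
Proof. by []. Qed.

Lemma sl_bracketDl g h (k : sl F n) :
  sl_bracket (g + h) k = sl_bracket g k + sl_bracket h k.
Proof.
apply: sl_inj; rewrite slvalD !sl_bracketE !slvalD mulmxDl mulmxDr opprD addrACA //.
Qed.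

Lemma sl_bracketZl a g (k : sl F n) : sl_bracket (a *: g) k = a *: sl_bracket g k.
Proof.
by apply: sl_inj; rewrite slvalZ !sl_bracketE slvalZ -scalemxAl -scalemxAr scalerBr.
Qed.

Lemma sl_bracket_anti g (k : sl F n) : sl_bracket k g = - sl_bracket g k.
Proof. by apply: sl_inj; rewrite slvalN !sl_bracketE opprB. Qed.

Lemma sl_bracketDr g h (k : sl F n) :
  sl_bracket k (g + h) = sl_bracket k g + sl_bracket k h.
Proof.
by rewrite sl_bracket_anti sl_bracketDl opprD -!(sl_bracket_anti _ k).
Qed.

Lemma sl_bracketZr a g (k : sl F n) : sl_bracket k (a *: g) = a *: sl_bracket k g.
Proof. by rewrite sl_bracket_anti sl_bracketZl -scalerN -sl_bracket_anti. Qed.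

Lemma sl_bracketxx g : sl_bracket g g = 0.
Proof. by apply: sl_inj; rewrite sl_bracketE subrr. Qed.

Lemma sl_bracket0l (k : sl F n) : sl_bracket 0 k = 0.
Proof. by rewrite -{1}(scale0r (0 : sl F n)) sl_bracketZl scale0r. Qed.

Lemma slproj_subproof A : A - (\tr A / n%:R)%:M \in @trace0 F n.
Proof.
rewrite inE raddfB /= mxtrace_scalar; case: n A => [|m] A.
  by rewrite [A]flatmx0 mxtrace0 mul0r mul0rn subrr.
by rewrite -[_ / _ *+ _]mulr_natr mulfVK ?subrr // pnatr_eq0.
Qed.

(** The projection of gl_n onto sl_n along the scalar matrices; through it, linear maps on sl_n are
    computed on matrix units. *)
Definition slproj A : sl F n := SL (slproj_subproof A).

Lemma slproj_is_linear : linear slproj.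
Proof.
move=> a A B; apply: sl_inj; rewrite slvalD slvalZ /=.
rewrite mxtraceD mxtraceZ mulrDl raddfD /= -mulrA -scale_scalar_mx scalerBr.
by rewrite opprD addrACA.
Qed.

HB.instance Definition _ := GRing.isLinear.Build F 'M[F]_n (sl F n) *:%R slproj
  slproj_is_linear.

Lemma slprojK g : slproj g = g.
Proof.
apply: sl_inj => /=; have := slvalP g; rewrite inE => /eqP ->.
by rewrite mul0r raddf0 subr0.
Qed.

(** Scalar matrices are central and commutators have trace zero, so the projection is a Lie
    homomorphism. *)
Lemma slproj_bracket A B :
  sl_bracket (slproj A) (slproj B) = slproj (A *m B - B *m A).
Proof.
apply: sl_inj => /=.
have -> : \tr (A *m B - B *m A) = 0 by rewrite raddfB /= mxtrace_mulC subrr.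
rewrite mul0r raddf0 subr0.
set a := _ / _; set b := _ / _.
have E (C D : 'M[F]_n) (x y : F) : (C - x%:M) *m (D - y%:M) =
    C *m D - (y *: C + x *: D - (x * y)%:M).
  rewrite mulmxBl !mulmxBr mul_mx_scalar !mul_scalar_mx scale_scalar_mx.
  by rewrite !opprD !opprK !addrA.
rewrite !E (addrC (a *: B)) (mulrC b).
by move: (b *: A + a *: B - _) => X; rewrite opprB addrA subrK.
Qed.

Lemma slproj1 : slproj 1%:M = 0.
Proof.
case: (posnP n) => [n0|n_gt0]; apply: sl_inj => /=.
  by apply/matrixP => i; have := leq_trans (ltn_ord i) (eq_leq n0); rewrite ltn0.
rewrite mxtrace_scalar divff ?subrr //; by rewrite pnatr_eq0 -lt0n.
Qed.

Lemma slval_slproj A : \tr A = 0 -> slval (slproj A) = A.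
Proof. by move=> /= ->; rewrite mul0r raddf0 subr0. Qed.

(** After [slproj], all E_ii have the same image under [f]; these images add up to the image of the
    identity, which is 0, and characteristic 0 permits division by n. *)
Lemma sl_linear_eq0 (V : lmodType F) (f : {linear sl F n -> V}) :
  (forall i j, i != j -> f (slproj (delta_mx i j)) = 0) ->
  (forall i j, i != j -> f (slproj (delta_mx i i - delta_mx j j)) = 0) ->
  forall g, f g = 0.
Proof.
move=> foff fdiag g; rewrite -(slprojK g) (matrix_sum_delta g) !linear_sum /=.
apply: big1 => i _; rewrite !linear_sum /=; apply: big1 => j _.
rewrite !linearZ_LR /=; have [<-{j}|/foff ->] := eqVneq i j; last exact: scaler0.
have E j : f (slproj (delta_mx j j)) = f (slproj (delta_mx i i)).
  have [->//|/fdiag] := eqVneq j i.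
  by rewrite !raddfB /= => /eqP; rewrite subr_eq0 => /eqP.
have : f (slproj 1%:M) = 0 by rewrite slproj1 linear0.
rewrite mx1_sum_delta !linear_sum /=.
rewrite (eq_bigr _ (fun j _ => E j)) sumr_const card_ord -scaler_nat => /eqP.
rewrite scaler_eq0 pnatr_eq0 => /orP[/eqP n0|/eqP ->]; last exact: scaler0.
by have := leq_trans (ltn_ord i) (eq_leq n0); rewrite ltn0.
Qed.

(* In terms of the matrix units E_ij, the elements E_ii - E_jj and
   E_ii - E_jj + E_ij are tripotent. *)
Lemma tripotent_span (V : lmodType F) (f : {linear sl F n -> V}) :
  (forall h : sl F n, h *m h *m h = slval h -> f h = 0) -> forall g, f g = 0.
Proof.
move=> f3.
have f3' A : \tr A = 0 -> A *m A *m A = A -> f (slproj A) = 0.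
  by move=> A0 A3; apply: f3; rewrite !slval_slproj.
have trE i j : i != j -> \tr (delta_mx i j : 'M[F]_n) = 0.
  move=> ij; rewrite /mxtrace big1 // => k _; rewrite mxE.
  by have [->|] := eqVneq k i; rewrite ?(negPf ij).
have trEE i j : \tr (delta_mx i i - delta_mx j j : 'M[F]_n) = 0.
  have E k : \tr (delta_mx k k : 'M[F]_n) = 1.
    rewrite /mxtrace (bigD1 k) //= mxE !eqxx big1 ?addr0 // => l lk.
    by rewrite mxE (negPf lk).
  by rewrite raddfB /= !E subrr.
pose mulE := (@mulmxDl F n n n, @mulmxDr F n n n, @mulNmx F n n n,
  @mulmxN F n n n, @mul_delta_mx_cond F n n n, @mul0mx F n n n, @mulmx0 F n n n,
  @eqxx, @mulr1n, @mulr0n, @oppr0, @addr0, @add0r, @opprK).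
have dd i j : i != j -> f (slproj (delta_mx i i - delta_mx j j)) = 0.
  move=> ij; have ji : j != i by rewrite eq_sym.
  apply: f3'; rewrite ?trEE //; set S := _ - _.
  have -> : S *m S = delta_mx i i + delta_mx j j.
    by rewrite /S !(mulE, negPf ij, negPf ji).
  by rewrite /S !(mulE, negPf ij, negPf ji).
apply: sl_linear_eq0 => // i j ij; have ji : j != i by rewrite eq_sym.
have <- : delta_mx i i - delta_mx j j + delta_mx i j
          - (delta_mx i i - delta_mx j j) = delta_mx i j :> 'M[F]_n.
  by rewrite addrAC subrr add0r.
rewrite (raddfB slproj) (raddfB f) /= dd // subr0; apply: f3'.
  by rewrite mxtraceD trEE trE // addr0.
set S := _ + delta_mx i j.
have -> : S *m S = delta_mx i i + delta_mx j j.
  rewrite /S !(mulE, negPf ij, negPf ji).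
  by rewrite addrAC addrK.
by rewrite /S !(mulE, negPf ij, negPf ji) addrAC.
Qed.

(* From an element of the kernel, brackets with matrix units produce
   one E_ij with i != j, then all of them. *)
Lemma sl_simple (V : lmodType F) (f : {linear sl F n -> V}) :
  (forall g (k : sl F n), f g = 0 -> f (sl_bracket g k) = 0) ->
  (exists2 g, g != 0 & f g = 0) -> forall g, f g = 0.
Proof.
move=> fK [g g0 fg].
pose K A := f (slproj A) = 0.
have KB A B : K A -> K (A *m B - B *m A).
  by move=> KA; rewrite /K -slproj_bracket; apply: fK.
have KZ c A : c != 0 -> K (c *: A) -> K A.
  rewrite /K !linearZ_LR => c0 /eqP; rewrite scaler_eq0 (negPf c0) => /eqP.
  by [].
have KN A : K (- A) -> K A.
  by rewrite /K !raddfN /= => /eqP; rewrite oppr_eq0 => /eqP.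
have Kg : K g by rewrite /K slprojK.
have two0 : 2%:R != 0 :> F by rewrite pnatr_eq0.
have [i [j [ij Kij]]] : exists i j, i != j /\ K (delta_mx i j).
  have [/existsP[i /existsP[j /andP[ij gij]]]|goff] :=
    boolP [exists i, exists j, (i != j) && (slval g i j != 0)].
    (* For E = E_ji, E^2 = 0 gives [[g, E], E] = -2 E g E = -2 g_ij E. *)
    exists j, i; split; first by rewrite eq_sym.
    pose E : 'M[F]_n := delta_mx j i.
    have E2 : E *m E = 0 by rewrite mul_delta_mx_0.
    have EgE : E *m g *m E = slval g i j *: E.
      apply/matrixP => a b; rewrite !mxE (bigD1 j) //= big1 => [|c cj].
        rewrite !mxE (bigD1 i) //= big1 => [|c ci].
          rewrite !mxE !eqxx !andbT addr0 addr0 /=.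
          by case: (a == j); case: (b == i); rewrite ?(mulr0, mul0r, mulr1, mul1r).
        by rewrite !mxE (negPf ci) andbF mul0r.
      by rewrite !mxE (negPf cj) mulr0.
    have := KB _ E (KB _ E Kg); rewrite mulmxBl mulmxBr !mulmxA -!(mulmxA _ E E).
    rewrite !E2 mulmx0 !mul0mx sub0r subr0 EgE -opprD => /KN.
    rewrite -mulr2n -scaler_nat => /(KZ _ _ two0) /KZ; exact.
  have g_diag i j : i != j -> slval g i j = 0.
    move=> ij; apply/eqP; apply: contraNT goff => gij.
    by apply/existsP; exists i; apply/existsP; exists j; rewrite ij.
  have [/existsP[i /existsP[j gij]]|geq] :=
    boolP [exists i, exists j, slval g i i != slval g j j].
    have ij : i != j by apply: contraNneq gij => ->.
    (* For diagonal g, [g, E_ij] = (g_ii - g_jj) E_ij. *)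
    exists i, j; split => //; apply: (KZ (slval g i i - slval g j j)).
      by rewrite subr_eq0.
    have := KB _ (delta_mx i j) Kg; congr K.
    apply/matrixP => a b; rewrite !mxE.
    rewrite (bigD1 i) //= big1 ?addr0 => [|c ci]; last first.
      by rewrite !mxE (negPf ci) mulr0.
    rewrite (bigD1 j) //= big1 ?addr0 => [|c ci]; last first.
      by rewrite !mxE (negPf ci) andbF mul0r.
    rewrite !mxE !eqxx /= andbT.
    have [->|ai] := eqVneq a i; have [->|bj] := eqVneq b j;
      rewrite /= ?(mulr0, mul0r, mulr1, mul1r, subr0, sub0r) //.
    - by rewrite g_diag ?oppr0 // eq_sym.
    - by rewrite g_diag.
    - by rewrite oppr0.
  (* What remains is a scalar matrix of trace zero, which vanishes in characteristic 0. *)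
  case/negP: g0; apply/eqP; apply: sl_inj.
  have [n0|n_gt0] := posnP n; first
    by apply/matrixP => k; have := leq_trans (ltn_ord k) (eq_leq n0); rewrite ltn0.
  have i0 := Ordinal n_gt0.
  have gE : slval g = (slval g i0 i0)%:M.
    apply/matrixP => k l; rewrite mxE; case: eqVneq => [<-|/g_diag->//].
    rewrite mulr1n; apply/eqP; apply: contraNT geq => gi.
    by apply/existsP; exists k; apply/existsP; exists i0.
  have := slvalP g; rewrite inE gE mxtrace_scalar -mulr_natr mulf_eq0 pnatr_eq0.
  by rewrite eqn0Ngt n_gt0 orbF => /eqP ->; rewrite raddf0.
have Krow a b c : a != b -> c != a -> K (delta_mx a b) -> K (delta_mx a c).
  move=> ab ca /(KB _ (delta_mx b c)).
  by rewrite mul_delta_mx mul_delta_mx_cond (negPf ca) mulr0n subr0.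
have KD a b : K (delta_mx a b) -> K (delta_mx a a - delta_mx b b).
  by move=> /(KB _ (delta_mx b a)); rewrite !mul_delta_mx.
(* [[E_ab, E_ba], E_ba] = -2 E_ba. *)
have Kflip a b : a != b -> K (delta_mx a b) -> K (delta_mx b a).
  move=> ab /KD /(KB _ (delta_mx b a)).
  rewrite mulmxBl mulmxBr !mul_delta_mx !mul_delta_mx_cond (negPf ab) mulr0n.
  rewrite subr0 sub0r -opprD => /KN.
  rewrite -mulr2n -scaler_nat; exact: KZ.
have Kall k l : k != l -> K (delta_mx k l).
  move=> kl; have [ki|ki] := eqVneq k i.
    by rewrite ki in kl *; apply: (Krow i j) => //; rewrite eq_sym.
  (* The chain is E_ij, E_ik, E_ki, E_kl. *)
  apply: (Krow k i) => //; first by rewrite eq_sym.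
  by apply: Kflip; rewrite 1?eq_sym //; apply: (Krow i j).
by apply: sl_linear_eq0 => // k l kl; apply/KD/Kall.
Qed.

(* With the idempotents P_c of h for the eigenvalues c = 1, -1, 0, any matrix A is
   the sum of the ad-eigenvectors P_c A P_d. *)
Lemma tripotent_ad_ind (h : 'M[F]_n) (Q : 'M[F]_n -> Prop) :
  h *m h *m h = h ->
  (forall A B, Q A -> Q B -> Q (A + B)) ->
  (forall c A, A *m h - h *m A = c *: A -> Q A) -> forall A, Q A.
Proof.
move=> h3 QD Qe A.
have two0 : 2%:R != 0 :> F by rewrite pnatr_eq0.
pose eig c (p : 'M[F]_n) := h *m p = c *: p /\ p *m h = c *: p.
(* From h p = c p and q h = d q, p A q is an ad-eigenvector with eigenvalue d - c. *)
have QE c d p q : eig c p -> eig d q -> Q (p *m A *m q).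
  move=> [hp _] [_ qh]; apply: (Qe (d - c)).
  by rewrite -!mulmxA qh !mulmxA hp -!scalemxAr -!scalemxAl scalerBl.
have h3' : h *m (h *m h) = h by rewrite mulmxA.
have e1 : eig 1 (2%:R^-1 *: (h *m h + h)).
  split; rewrite scale1r -?scalemxAr -?scalemxAl ?mulmxDl ?mulmxDr ?h3 ?h3';
  by rewrite addrC.
have e2 : eig (-1) (2%:R^-1 *: (h *m h - h)).
  split; rewrite scaleN1r -?scalemxAr -?scalemxAl ?mulmxBl ?mulmxBr ?h3 ?h3';
  by rewrite -scalerN opprB.
have e3 : eig 0 (1%:M - h *m h).
  by split; rewrite scale0r ?mulmxBl ?mulmxBr ?mulmx1 ?mul1mx ?h3 ?h3' subrr.
move: e1 e2 e3; set p1 := _ *: _; set p2 := _ *: _; set p3 := _ - _ => e1 e2 e3.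
have p1E : p1 + p2 + p3 = 1%:M.
  rewrite /p1 /p2 /p3 -scalerDr addrACA subrr addr0 -mulr2n -scaler_nat scalerA.
  by rewrite mulVf // scale1r addrC subrK.
clearbody p1 p2 p3; rewrite -[A]mulmx1 -[A]mul1mx -p1E !(mulmxDl, mulmxDr).
by do ![apply: (QD)]; eapply QE; eassumption.
Qed.

End SpecialLinear.

Arguments slproj : simpl never.
Arguments sl_bracket : simpl never.

(** * Irreducible modules and their maps from the adjoint module *)

Section SimpleModule.
Context {F : numClosedFieldType} {n d : nat} {rho : {linear sl F n -> 'M[F]_d}}.
Hypothesis rho_bracket : forall g h : sl F n,
  rho (sl_bracket g h) = rho g *m rho h - rho h *m rho g.
Hypothesis rho_irr : irreducible_module rho.
Hypothesis rho_nontrivial : nontrivial_action rho.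
Implicit Types (g h : sl F n) (u v : 'rV[F]_d).

(** The kernel of [rho] is an ideal of the simple algebra sl_n, and it is proper because the action
    is nontrivial. *)
Lemma module_faithful g : rho g = 0 -> g = 0.
Proof.
move=> rg; apply/eqP; apply: contraT => g0.
have [h /eqP[]] := rho_nontrivial.
apply: (@sl_simple F n _ rho); last by exists g.
by move=> k l rk; rewrite rho_bracket rk mul0mx mulmx0 subrr.
Qed.

(* The sum of the eigenspaces of rho h is a submodule, because rho maps
   ad-eigenvectors of h to operators shifting the eigenspaces. *)
Lemma tripotent_eigen_eq0 h m (M : 'M[F]_(d, m)) : h *m h *m h = slval h ->
  (forall c u, u *m rho h = c *: u -> u *m M = 0) -> M = 0.
Proof.
move=> h3 uM; have [d_gt0 irr] := rho_irr.
have [s sE] := closed_field_poly_normal (char_poly (rho h)).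
(* The sum runs over root positions, so an eigenspace may be repeated. *)
pose W := (\sum_(i < size s) eigenspace (rho h) s`_i)%MS.
have eigW c : (eigenspace (rho h) c <= W)%MS.
  have [->|e0] := eqVneq (eigenspace (rho h) c) 0; first exact: sub0mx.
  have : eigenvalue (rho h) c by [].
  rewrite eigenvalue_root_char sE (monicP (char_poly_monic _)) scale1r.
  rewrite root_prod_XsubC => cs.
  rewrite -(nth_index 0 cs); move: cs; rewrite -index_mem => cs.
  exact: (sumsmx_sup (Ordinal cs)).
have Wstable A : (W *m rho (slproj A) <= W)%MS.
  move: A; apply: (@tripotent_ad_ind F n h
      (fun A => W *m rho (slproj A) <= W)%MS h3) => [A B|c A Ac].
    by rewrite linearD linearD /= mulmxDr => WA WB; apply: addmx_sub.
  rewrite sumsmxMr; apply/sumsmx_subP => i _; set U := eigenspace _ _.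
  have Uh : U *m rho h = s`_i *: U by apply/eigenspaceP.
  apply: submx_trans (eigW (s`_i + c)); apply/eigenspaceP.
  have /eqP : rho (slproj A) *m rho h - rho h *m rho (slproj A)
              = c *: rho (slproj A).
    by rewrite -rho_bracket -{1}(slprojK h) slproj_bracket Ac !linearZ.
  rewrite subr_eq => /eqP E.
  rewrite -mulmxA E mulmxDr -scalemxAr mulmxA Uh -scalemxAl -scalerDl.
  by rewrite addrC.
have [g|W0|W_full] := irr W.
- by rewrite -(slprojK g).
(* Over an algebraically closed field [rho h] has an eigenvector, so [W] is nonzero. *)
- have [c] := eigenvalue_closed (rho h) d_gt0.
  by rewrite /eigenvalue -submx0 -W0 eigW.
- apply/eqP; rewrite -submx0 -(mul1mx M).
  have WM : (W <= kermx M)%MS.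
    apply/sumsmx_subP => i _; apply/sub_kermxP/row_matrixP => k.
    rewrite row_mul row0; apply: (uM s`_i).
    by rewrite -row_mul (eigenspaceP (submx_refl _)) linearZ.
  have /sub_kermxP -> : (1%:M <= kermx M)%MS.
    by apply: submx_trans WM; rewrite submx_full.
  exact: sub0mx.
Qed.

(** For linear [f], these are the module homomorphisms from the adjoint module to I. *)
Definition equivariant (f : sl F n -> 'rV[F]_d) :=
  forall g h, f (sl_bracket g h) = f g *m rho h.

(** The kernel is a proper ideal of sl_n. *)
Lemma equivariant_inj (f : {linear sl F n -> 'rV[F]_d}) :
  equivariant f -> (exists g, f g <> 0) -> injective f.
Proof.
move=> fE [g0 fg0] g h /eqP; rewrite -subr_eq0 -raddfB => /eqP fgh.
apply/eqP; rewrite -subr_eq0; apply: contraT => gh; case: fg0.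
apply: (@sl_simple F n _ f); last by exists (g - h).
by move=> k l fk; rewrite fE fk mul0mx.
Qed.

(** The image is a nonzero submodule of I. The matrix represents [t] extended by 0 to the scalar
    matrices. *)
Lemma equivariant_row_full (t : {linear sl F n -> 'rV[F]_d}) :
  equivariant t -> (exists g, t g <> 0) ->
  row_full (lin1_mx (t \o slproj \o vec_mx)).
Proof.
move=> tE [g0 tg0]; have [d_gt0 irr] := rho_irr; set T := lin1_mx _.
have TE A : mxvec A *m T = t (slproj A) by rewrite mul_rV_lin1 /= mxvecK.
have [g|T0|] := irr <<T>>%MS; last by rewrite /row_full genmxE.
  rewrite (eqmxMr _ (genmxE T)) genmxE; apply/row_subP => i.
  rewrite row_mul rowE mul_rV_lin1 /= -tE -[sl_bracket _ _]slprojK -TE.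
  exact: submxMl.
case: tg0; rewrite -(slprojK g0) -TE.
suff -> : T = 0 by rewrite mulmx0.
by apply/eqP; rewrite -submx0 -T0 genmxE.
Qed.

Lemma equivariant_surj (t : {linear sl F n -> 'rV[F]_d}) :
  equivariant t -> (exists g, t g <> 0) -> forall v, exists g, t g = v.
Proof.
move=> tE t0 v; have Tf := equivariant_row_full _ tE t0.
have /mulmxKpV E := submx_full v Tf.
by exists (slproj (vec_mx (v *m pinvmx (lin1_mx (t \o slproj \o vec_mx)))));
  rewrite -[RHS]E mul_rV_lin1.
Qed.

(* Schur's lemma: f - c t is not injective when c is an eigenvalue of f \o t^-1. *)
Lemma equivariant_schur (f t : {linear sl F n -> 'rV[F]_d}) :
  equivariant f -> equivariant t -> (exists g, t g <> 0) ->
  exists c, forall g, f g = c *: t g.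
Proof.
move=> fE tE t0; have [d_gt0 irr] := rho_irr.
pose T := lin1_mx (t \o slproj \o vec_mx).
have T_full : row_full T by apply: equivariant_row_full.
(* [pinvmx T] is a section of [t], so [S] plays the role of f \o t^-1. *)
pose S := pinvmx T *m lin1_mx (f \o slproj \o vec_mx).
have [c /eigenvalueP[v vS v0]] := eigenvalue_closed S d_gt0.
pose g := slproj (vec_mx (v *m pinvmx T)).
have tg : t g = v.
  have -> : t g = v *m pinvmx T *m T by rewrite mul_rV_lin1.
  by rewrite mulmxKpV // submx_full.
have fg : f g = c *: v by rewrite -vS /S mulmxA mul_rV_lin1 /=.
exists c => k; apply/eqP; rewrite -subr_eq0; apply/eqP.
have lin : linear (fun k => f k - c *: t k).
  move=> a x y; rewrite (linearP f) (linearP t) [c *: (_ + _)]scalerDr opprD addrACA.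
  by rewrite scalerBr !scalerA (mulrC c).
pose e : {linear sl F n -> 'rV[F]_d} :=
  HB.pack (fun k => f k - c *: t k) (GRing.isLinear.Build _ _ _ _ _ lin).
apply: (@sl_simple F n _ e) => [{}k l|].
  by rewrite /= fE tE scalemxAl -mulmxBl => ->; rewrite mul0mx.
(* The preimage of an eigenvector of [S] is a nonzero kernel element, and simplicity enlarges the
   kernel to sl_n. *)
exists g; last by rewrite /= tg fg subrr.
by apply: contraNneq v0 => g0'; rewrite -tg g0' linear0.
Qed.

End SimpleModule.

(** With coefficients a, c, b at x, x0, x + x0, injectivity of [k] gives (a - b) x = (b - c) x0:
    either all coefficients agree or x is a multiple of x0. *)
Lemma linear_proportional (F : fieldType) (U V : lmodType F)
    (f k : {linear U -> V}) :
  injective k -> (exists x : U, x != 0) ->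
  (forall x, exists c, f x = c *: k x) -> exists c, forall x, f x = c *: k x.
Proof.
move=> k_inj [x0 x0_neq0] fk; have [c fx0] := fk x0; exists c => x.
have [a fx] := fk x; have [b E] := fk (x + x0).
rewrite !linearD /= fx fx0 in E.
have {E} : k ((a - b) *: x) = k ((b - c) *: x0).
  rewrite !linearZ_LR /= !scalerBl; apply/eqP.
  by rewrite subr_eq addrAC eq_sym subr_eq E addrC.
move=> /k_inj E; have [ab|ab] := eqVneq a b.
  move/esym/eqP: E; rewrite ab subrr scale0r scaler_eq0 (negPf x0_neq0) orbF.
  by rewrite subr_eq0 fx ab => /eqP <-.
have ab0 : a - b != 0 by rewrite subr_eq0.
have -> : x = ((a - b)^-1 * (b - c)) *: x0.
  by rewrite -scalerA -E scalerA mulVf ?scale1r.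
by rewrite (linearZ_LR f) (linearZ_LR k) fx0 !scalerA mulrC.
Qed.

(** * Block components of linear maps on sl_n + I *)

Section Parts.
Context {F : numClosedFieldType} {n d : nat}.
Local Notation L := (Lalg F n d).
Implicit Types Phi : {linear L -> L}.

(** The block from I to sl_n gets no name: it vanishes for automorphisms and for local
    automorphisms. *)
Definition sl_part Phi (g : sl F n) : sl F n := (Phi (g, 0)).1.
Definition mix_part Phi (g : sl F n) : 'rV[F]_d := (Phi (g, 0)).2.
Definition ideal_part Phi (v : 'rV[F]_d) : 'rV[F]_d := (Phi (0, v)).2.

Lemma pairZD0 a (g h : sl F n) :
  (a *: g + h, 0) = a *: ((g, 0) : L) + (h, 0).
Proof. by congr pair; rewrite /= scaler0 addr0. Qed.

Lemma pair0ZD a (u v : 'rV[F]_d) :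
  (0, a *: u + v) = a *: ((0, u) : L) + (0, v).
Proof. by congr pair; rewrite /= scaler0 addr0. Qed.

Lemma sl_part_is_linear Phi : linear (sl_part Phi).
Proof. by move=> a g h; rewrite /sl_part pairZD0 linearP. Qed.

Lemma mix_part_is_linear Phi : linear (mix_part Phi).
Proof. by move=> a g h; rewrite /mix_part pairZD0 linearP. Qed.

Lemma ideal_part_is_linear Phi : linear (ideal_part Phi).
Proof. by move=> a u v; rewrite /ideal_part pair0ZD linearP. Qed.

HB.instance Definition _ Phi := GRing.isLinear.Build F (sl F n) (sl F n) *:%R
  (sl_part Phi) (sl_part_is_linear Phi).
HB.instance Definition _ Phi := GRing.isLinear.Build F (sl F n) 'rV[F]_d *:%R
  (mix_part Phi) (mix_part_is_linear Phi).
HB.instance Definition _ Phi := GRing.isLinear.Build F 'rV[F]_d 'rV[F]_d *:%R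
  (ideal_part Phi) (ideal_part_is_linear Phi).

Lemma partsE Phi g v : (forall u, (Phi (0, u)).1 = 0) ->
  Phi (g, v) = (sl_part Phi g, mix_part Phi g + ideal_part Phi v).
Proof.
move=> Phi0; have -> : (g, v) = (g, 0) + (0, v) :> L.
  by congr pair; rewrite /= ?addr0 ?add0r.
by rewrite linearD; apply: injective_projections; rewrite //= Phi0 addr0.
Qed.

(* The complement of sl_n in gl_n is spanned by the identity; extending by the
   identity there puts the map on a vectType. *)
Lemma injective_bijective Phi : injective Phi -> bijective Phi.
Proof.
move=> Phi_inj.
pose p (x : 'M[F]_n * 'rV[F]_d) : L := (slproj x.1, x.2).
have [s [sL sE]] : exists s : 'M[F]_n -> 'M[F]_n,
    linear s /\ forall A, s A = slval (slproj A).
  exists (fun A => slval (slproj A)); split=> // a A B.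
  by rewrite (linearP slproj) slvalD slvalZ.
pose E1 (x : 'M[F]_n * 'rV[F]_d) := slval (Phi (p x)).1 + (x.1 - s x.1).
pose E x := (E1 x, (Phi (p x)).2).
have pL : linear p by move=> a x y; rewrite /p /= linearP.
have fstP (U V : lmodType F) a (x y : U * V) : (a *: x + y).1 = a *: x.1 + y.1.
  by [].
have E1L : linear E1.
  move=> a x y; rewrite /E1 pL (linearP Phi) !fstP sL !slvalD !slvalZ.
  by rewrite opprD [X in _ + X = _]addrACA [LHS]addrACA !scalerDr scalerN.
have EL : linear E.
  by move=> a x y; rewrite /E E1L pL (linearP Phi).
pose E' : {linear _ -> _} := HB.pack E (GRing.isLinear.Build _ _ _ _ E EL).
(* Hence [slproj] recovers the sl_n component of [Phi (p x)] from [E1 x]. *)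
have proj_compl (A : 'M[F]_n) : slproj (A - s A) = 0.
  by rewrite raddfB /= sE slprojK subrr.
have LE x : linfun E' x = E x by exact: (lfunE E').
have E_inj : injective (linfun E').
  move=> x1 x2; rewrite !LE; move: x1 x2; apply: (raddf_inj (f := E')) => x Ex.
  have [Ex1 Ex2] : (E x).1 = 0 /\ (E x).2 = 0 by rewrite [E x]Ex.
  have Px : Phi (p x) = 0.
    apply: injective_projections => //=; rewrite -[LHS]slprojK.
    by move: (congr1 slproj Ex1); rewrite linear0 /= linearD /= proj_compl addr0.
  have px : p x = 0 by apply: Phi_inj; rewrite Px linear0.
  have p1 : slproj x.1 = 0 := congr1 fst px.
  have p2 : x.2 = 0 := congr1 snd px.
  apply: injective_projections => //=.
  by move: Ex1; rewrite /= /E1 sE Px p1 subr0 add0r.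
have E_surj := lker0_lfunVK (introT lker0P E_inj).
have Phi_surj y : exists x, Phi x == y.
  exists (p ((linfun E')^-1%VF (slval y.1, y.2))); apply/eqP.
  have := E_surj (slval y.1, y.2); rewrite LE /=; set x := (_^-1)%VF _.
  case=> x1 x2; apply: injective_projections => //.
  rewrite -[LHS]slprojK -[RHS]slprojK -x1 [RHS]linearD /= proj_compl addr0.
  by [].
exists (fun y => xchoose (Phi_surj y)) => [x|y].
  by apply: Phi_inj; apply/eqP; apply: (xchooseP (Phi_surj (Phi x))).
by apply/eqP; apply: (xchooseP (Phi_surj y)).
Qed.

End Parts.

(** * Automorphisms in block form *)

Section Automorphisms.
Context {F : numClosedFieldType} {n d : nat} {rho : {linear sl F n -> 'M[F]_d}}.
Hypothesis rho_bracket : forall g h : sl F n,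
  rho (sl_bracket g h) = rho g *m rho h - rho h *m rho g.
Hypothesis rho_irr : irreducible_module rho.
Hypothesis rho_nontrivial : nontrivial_action rho.
Local Notation L := (Lalg F n d).
Implicit Types (Phi : {linear L -> L}) (g h : sl F n) (u v : 'rV[F]_d).

(* The ideal is spanned by the squares [x, x] = (0, v *m rho g). *)
Lemma automorphism_ideal Phi : is_automorphism rho Phi ->
  forall v, (Phi (0, v)).1 = 0.
Proof.
case=> _ _ PhiB v.
pose P := lin1_mx (fun u => mxvec (slval (Phi (0, u)).1)).
have PL : linear (fun u => mxvec (slval (Phi (0, u)).1)).
  move=> a u w; rewrite pair0ZD (linearP Phi).
  by rewrite [X in mxvec (slval X)]/= slvalD slvalZ linearP.
pose p : {linear 'rV[F]_d -> 'rV[F]_(n * n)} :=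
  HB.pack (fun u => mxvec (slval (Phi (0, u)).1))
    (GRing.isLinear.Build _ _ _ _ _ PL).
have PE u : u *m P = mxvec (slval (Phi (0, u)).1) by rewrite (mul_rV_lin1 p).
have rhoP g : rho g *m P = 0.
  apply/row_matrixP => i; rewrite row0 row_mul PE.
  have -> : (0, row i (rho g)) =
      Lbracket rho (g, delta_mx 0 i) (g, delta_mx 0 i) :> L.
    by rewrite /Lbracket sl_bracketxx rowE.
  by rewrite PhiB [(Lbracket _ _ _).1]sl_bracketxx; apply: linear0.
have [d_gt0 irr] := rho_irr.
(* The kernel contains the image of every [rho g], so it is a submodule, nonzero because the action
   is nontrivial. *)
have [g|K0|K_full] := irr (kermx P).
- by apply: submx_trans (submxMl _ _) _; apply/sub_kermxP.
- case: rho_nontrivial => g /eqP[]; apply/eqP; rewrite -submx0 -K0.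
  exact/sub_kermxP.
- have /sub_kermxP : (v <= kermx P)%MS by apply: submx_full.
  rewrite PE => E; apply: sl_inj; apply: (can_inj mxvecK).
  by rewrite E; apply/esym/linear0.
Qed.

(** Evaluate [Phi] on the brackets of (g, 0) and (0, v) with (h, 0); only the sl_n component of a
    right factor acts on I. *)
Lemma automorphism_parts Phi : is_automorphism rho Phi ->
  [/\ forall g h, sl_part Phi (sl_bracket g h) =
                  sl_bracket (sl_part Phi g) (sl_part Phi h),
      forall g h, mix_part Phi (sl_bracket g h) =
                  mix_part Phi g *m rho (sl_part Phi h) &
      forall v h, ideal_part Phi (v *m rho h) =
                  ideal_part Phi v *m rho (sl_part Phi h)].
Proof.
move=> aut; have Phi0 := automorphism_ideal _ aut; have [_ _ PhiB] := aut.
have E1 g h : (sl_bracket g h, 0) = Lbracket rho (g, 0) (h, 0) :> L.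
  by rewrite /Lbracket /= mul0mx.
have E2 v h : (0, v *m rho h) = Lbracket rho (0, v) (h, 0) :> L.
  by rewrite /Lbracket sl_bracket0l.
split=> [g h|g h|v h].
- by rewrite /sl_part E1 PhiB.
- by rewrite /mix_part E1 PhiB.
- by rewrite /ideal_part E2 PhiB.
Qed.

Lemma automorphism_of_parts Phi :
  injective Phi -> (forall v, (Phi (0, v)).1 = 0) ->
  (forall g h, sl_part Phi (sl_bracket g h) =
               sl_bracket (sl_part Phi g) (sl_part Phi h)) ->
  (forall g h, mix_part Phi (sl_bracket g h) =
               mix_part Phi g *m rho (sl_part Phi h)) ->
  (forall v h, ideal_part Phi (v *m rho h) =
               ideal_part Phi v *m rho (sl_part Phi h)) ->
  is_automorphism rho Phi.
Proof.
move=> Phi_inj Phi0 slE mixE idE; split; first exact: linearP.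
  exact: injective_bijective.
move=> [g u] [h v]; rewrite !(partsE _ _ _ Phi0) /=.
by rewrite slE mixE idE /Lbracket mulmxDl.
Qed.

(** Both maps are block triangular, so their diagonal blocks on sl_n are mutually inverse. *)
Lemma automorphism_inverse Phi : is_automorphism rho Phi ->
  exists Psi : {linear L -> L}, [/\ is_automorphism rho Psi,
    cancel (sl_part Phi) (sl_part Psi) & cancel (sl_part Psi) (sl_part Phi)].
Proof.
move=> aut; have [_ [psi PhiK psiK] PhiB] := aut.
have psiL : linear psi by apply: can2_linear PhiK psiK.
pose Psi : {linear L -> L} := HB.pack psi (GRing.isLinear.Build _ _ _ _ _ psiL).
have autPsi : is_automorphism rho Psi.
  split=> //; first by exists Phi.
  by move=> x y; apply: (can_inj PhiK); rewrite PhiB !psiK.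
have K1 : cancel Phi Psi := PhiK; have K2 : cancel Psi Phi := psiK.
exists Psi; split=> // g.
  have := K1 (g, 0); rewrite (partsE _ _ _ (automorphism_ideal _ aut)).
  by rewrite (partsE _ _ _ (automorphism_ideal _ autPsi)) => -[].
have := K2 (g, 0); rewrite (partsE _ _ _ (automorphism_ideal _ autPsi)).
by rewrite (partsE _ _ _ (automorphism_ideal _ aut)) => -[].
Qed.

(** Composing [f] with the inverse of the automorphism [sl_part Phi] removes the twist. *)
Lemma twisted_equivariant Phi (f : {linear sl F n -> 'rV[F]_d}) :
  is_automorphism rho Phi ->
  (forall g h, f (sl_bracket g h) = f g *m rho (sl_part Phi h)) ->
  exists2 e : {linear sl F n -> 'rV[F]_d},
    equivariant (rho := rho) e & forall g, f g = e (sl_part Phi g).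
Proof.
move=> aut fE; have [Psi [autPsi K1 K2]] := automorphism_inverse _ aut.
exists (f \o sl_part Psi) => [g h|g] /=; last by rewrite K1.
by have [-> _ _] := automorphism_parts _ autPsi; rewrite fE K2.
Qed.

End Automorphisms.

(** * Local automorphisms *)

Section LocalAutomorphism.
Context {F : numClosedFieldType} {n d : nat} {rho : {linear sl F n -> 'M[F]_d}}.
Hypothesis rho_bracket : forall g h : sl F n,
  rho (sl_bracket g h) = rho g *m rho h - rho h *m rho g.
Hypothesis rho_irr : irreducible_module rho.
Hypothesis rho_nontrivial : nontrivial_action rho.
Local Notation L := (Lalg F n d).
Context {Delta : {linear L -> L}}.
Hypothesis Delta_local : forall x : L,
  exists2 Phi : {linear L -> L}, is_automorphism rho Phi & Phi x = Delta x.
Implicit Types (Phi : {linear L -> L}) (g h : sl F n) (u v : 'rV[F]_d).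
Local Notation phi := (sl_part Delta).
Local Notation theta := (mix_part Delta).
Local Notation psi := (ideal_part Delta).

Lemma local_injective : injective Delta.
Proof.
apply: raddf_inj => x Dx; have [Phi [_ Phi_bij _] PhiE] := Delta_local x.
by apply: (bij_inj Phi_bij); rewrite PhiE linear0.
Qed.

Lemma local_ideal v : (Delta (0, v)).1 = 0.
Proof.
by have [Phi aut <-] := Delta_local (0, v); apply: (automorphism_ideal rho_irr).
Qed.

(** Locality at (g, v) read off componentwise, with one automorphism serving both equations. *)
Lemma local_at g v : exists Phi, [/\ is_automorphism rho Phi,
  sl_part Phi g = phi g &
  mix_part Phi g + ideal_part Phi v = theta g + psi v].
Proof.
have [Phi aut E] := Delta_local (g, v); exists Phi.
move: E; rewrite (partsE _ _ _ local_ideal).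
by rewrite (partsE _ _ _ (automorphism_ideal rho_irr rho_nontrivial _ aut)) => -[].
Qed.

Lemma phi_injective : injective phi.
Proof.
apply: raddf_inj => g phig; have [Phi [aut Phig _]] := local_at g 0.
have [Psi [_ K _]] := automorphism_inverse rho_irr rho_nontrivial _ aut.
by rewrite -(K g) Phig [phi g]phig linear0.
Qed.

Lemma psi_injective : injective psi.
Proof.
apply: raddf_inj => v v0.
have : Delta (0, v) = 0 by apply: injective_projections; rewrite ?local_ideal.
by rewrite -[RHS](linear0 Delta) => /local_injective[].
Qed.

(* It suffices to check that psi intertwines the eigenvectors of tripotent
   elements; faithfulness then forces phi to preserve brackets. *)
Lemma local_automorphism_eigen (f : {linear sl F n -> 'rV[F]_d}) :
  (forall h c v, h *m h *m h = slval h -> v *m rho h = c *: v ->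
     psi v *m rho (phi h) = c *: psi v) ->
  equivariant (rho := rho) f -> (forall g, theta g = f (phi g)) ->
  is_automorphism rho Delta.
Proof.
move=> eig fE thetaE.
pose P := lin1_mx psi.
have psiE v : psi v = v *m P by rewrite mul_rV_lin1.
have PL : linear (fun h => rho h *m P - P *m rho (phi h)).
  move=> a g h; rewrite (linearP phi) !(linearP rho) mulmxDl mulmxDr.
  rewrite -scalemxAl -scalemxAr.
  by rewrite opprD addrACA scalerBr.
pose D : {linear sl F n -> 'M[F]_d} :=
  HB.pack (fun h => rho h *m P - P *m rho (phi h))
    (GRing.isLinear.Build _ _ _ _ _ PL).
have rhoP h : rho h *m P = P *m rho (phi h).
  apply/eqP; rewrite -subr_eq0; apply/eqP; rewrite -[LHS]/(D h).
  apply: (@tripotent_span _ _ _ D) => k k3 /=.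
  apply: (tripotent_eigen_eq0 rho_bracket rho_irr _ _ _ k3) => c v vk.
  by rewrite mulmxBr !mulmxA vk -scalemxAl -!psiE (eig k c) // subrr.
have phiB g h : phi (sl_bracket g h) = sl_bracket (phi g) (phi h).
  apply/eqP; rewrite -subr_eq0; apply/eqP.
  apply: (module_faithful rho_bracket rho_nontrivial).
  (* [psi] is injective, so [P] can be cancelled once [rhoP] has moved it across the products. *)
  have P_inj (M : 'M[F]_d) : P *m M = 0 -> M = 0.
    have P_unit : P \in unitmx.
      rewrite -row_free_unit -kermx_eq0; apply/eqP/row_matrixP => i.
      rewrite row0; apply: psi_injective; rewrite linear0.
      by rewrite psiE -row_mul mulmx_ker row0.
    by move=> PM; rewrite -(mulKmx P_unit M) PM mulmx0.
  apply: P_inj; rewrite linearB mulmxBr /= -rhoP !rho_bracket mulmxBl mulmxBr.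
  by rewrite !mulmxA -!rhoP -!mulmxA -!rhoP subrr.
apply: automorphism_of_parts => //; first exact: local_injective.
- exact: local_ideal.
- by move=> g h; rewrite !thetaE phiB fE.
- by move=> v h; rewrite !psiE -!mulmxA rhoP.
Qed.

Lemma local_theta_eq0 :
  (forall Phi, is_automorphism rho Phi -> forall g, mix_part Phi g = 0) ->
  forall g, theta g = 0.
Proof.
move=> no_mix g; have [Phi [/no_mix mix0 _]] := local_at g 0.
by rewrite mix0 !linear0 !addr0 => <-.
Qed.

Lemma local_eigen_no_mix h c v :
  (forall Phi, is_automorphism rho Phi -> forall g, mix_part Phi g = 0) ->
  v *m rho h = c *: v -> psi v *m rho (phi h) = c *: psi v.
Proof.
move=> no_mix vh.
have [Phi [aut <-]] := local_at h v.
rewrite (local_theta_eq0 no_mix) no_mix // !add0r => <-.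
have [_ _ <-] := automorphism_parts rho_irr rho_nontrivial _ aut.
by rewrite vh linearZ.
Qed.

(** * The case where I is the adjoint module, identified through [tau] *)

Section AdjointType.
Context {tau : {linear sl F n -> 'rV[F]_d}}.
Hypothesis tau_equivariant : equivariant (rho := rho) tau.
Hypothesis tau_neq0 : exists g, tau g <> 0.

Let tau_inj : injective tau.
Proof. exact: equivariant_inj. Qed.

Lemma twisted_schur Phi (f : {linear sl F n -> 'rV[F]_d}) :
  is_automorphism rho Phi ->
  (forall g h, f (sl_bracket g h) = f g *m rho (sl_part Phi h)) ->
  exists c, forall g, f g = c *: tau (sl_part Phi g).
Proof.
move=> aut fE.
have [e eE feE] := twisted_equivariant rho_irr rho_nontrivial _ _ aut fE.
have [c ce] := equivariant_schur rho_irr _ _ eE tau_equivariant tau_neq0.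
by exists c => g; rewrite feE ce.
Qed.

(** Both maps are equivariant along [sl_part Phi], so Schur's lemma applies; c = 0 would contradict
    the injectivity of [Phi]. *)
Lemma adjoint_type_parts Phi : is_automorphism rho Phi ->
  exists b c, [/\ c != 0, forall g, mix_part Phi g = b *: tau (sl_part Phi g) &
    forall g, ideal_part Phi (tau g) = c *: tau (sl_part Phi g)].
Proof.
move=> aut; have [_ mixE idE] := automorphism_parts rho_irr rho_nontrivial _ aut.
have [b bE] := twisted_schur _ _ aut mixE.
have idtE g h : (ideal_part Phi \o tau) (sl_bracket g h) =
    (ideal_part Phi \o tau) g *m rho (sl_part Phi h).
  by rewrite /= tau_equivariant idE.
have [c cE] := twisted_schur _ (ideal_part Phi \o tau) aut idtE.
exists b, c; split=> //; apply/eqP => c0; have [g []] := tau_neq0.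
have := cE g; rewrite c0 scale0r /= => Phit0.
have [_ Phi_bij _] := aut.
have Phi0 := automorphism_ideal rho_irr rho_nontrivial _ aut.
have : Phi (0, tau g) = Phi 0.
  by apply: injective_projections; rewrite linear0 ?Phi0.
by move/(bij_inj Phi_bij) => [].
Qed.

(** Locality at (g, 0) gives a scalar depending on g; [linear_proportional] makes it uniform. *)
Lemma adjoint_type_theta : exists t, forall g, theta g = t *: tau (phi g).
Proof.
apply: (linear_proportional _ _ _ theta (tau \o phi)).
- exact: inj_comp tau_inj phi_injective.
- by have [g tg] := tau_neq0; exists g;
    apply: contra_notN tg => /eqP->; rewrite linear0.
- move=> g; have [Phi [aut phiE]] := local_at g 0.
  have [b [c [_ mixE _]]] := adjoint_type_parts _ aut.
  by rewrite !linear0 !addr0 => E; exists b; rewrite /= -E mixE phiE.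
Qed.

Lemma adjoint_type_psi :
  exists2 c, c != 0 & forall g, psi (tau g) = c *: tau (phi g).
Proof.
have [t tE] := adjoint_type_theta.
have [c cE] : exists c, forall g, psi (tau g) = c *: tau (phi g).
  apply: (linear_proportional _ _ _ (psi \o tau) (tau \o phi)).
  - exact: inj_comp tau_inj phi_injective.
  - by have [g tg] := tau_neq0; exists g;
    apply: contra_notN tg => /eqP->; rewrite linear0.
  (* At (g, tau g) the other three terms are multiples of [tau (phi g)], hence so is
     [psi (tau g)]. *)
  - move=> g; have [Phi [aut phiE]] := local_at g (tau g).
    have [b [c [_ mixE idE]]] := adjoint_type_parts _ aut.
    rewrite mixE idE phiE tE /= => E; exists (b + c - t).
    by rewrite scalerBl scalerDl E addrAC subrr add0r.
exists c => //; apply/eqP => c0; have [g []] := tau_neq0.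
by apply: psi_injective; rewrite cE c0 scale0r linear0.
Qed.

(* Delta sees two elements of sl_n at once: apply locality to (g, tau h). *)
Lemma adjoint_type_pair g h : exists Phi a s,
  [/\ is_automorphism rho Phi, a != 0, sl_part Phi g = phi g &
      sl_part Phi h = a *: phi h + s *: phi g].
Proof.
have [t tE] := adjoint_type_theta; have [c c0 cE] := adjoint_type_psi.
have [Phi [aut phiE]] := local_at g (tau h).
have [b [c' [c'0 mixE idE]]] := adjoint_type_parts _ aut.
rewrite mixE idE phiE tE cE => E.
(* These coefficients solve b phi g + c' x = t phi g + c phi h for x = [sl_part Phi h]. *)
exists Phi, (c'^-1 * c), (c'^-1 * (t - b)); split=> //.
  by rewrite mulf_neq0 ?invr_neq0.
apply: tau_inj; rewrite linearD !(linearZ_LR tau) -!scalerA -scalerDr scalerBl.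
apply: (scalerI c'0); rewrite scalerA divff // scale1r.
by rewrite addrCA addrA -E addrAC subrr add0r.
Qed.

Lemma adjoint_type_bracket h (v : sl F n) c :
  sl_bracket v h = c *: v -> sl_bracket (phi v) (phi h) = c *: phi v.
Proof.
move=> vh; have [->|v0] := eqVneq v 0.
  by rewrite linear0 scaler0 sl_bracket0l.
have [Phi [a [s [aut a0 Phih Phiv]]]] := adjoint_type_pair h v.
have [Psi [a' [s' [aut' a'0 Psiv Psih]]]] := adjoint_type_pair v h.
have [PhiB _ _] := automorphism_parts rho_irr rho_nontrivial _ aut.
have [PsiB _ _] := automorphism_parts rho_irr rho_nontrivial _ aut'.
(* [Psi] determines the eigenvalue up to the factor a'^-1. *)
have E : sl_bracket (phi v) (phi h) = (a'^-1 * c) *: phi v.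
  have := PsiB v h; rewrite vh linearZ_LR /= Psiv Psih sl_bracketDr !sl_bracketZr.
  rewrite sl_bracketxx scaler0 addr0 -scalerA => ->.
  by rewrite scalerA mulVf ?scale1r.
rewrite E; congr (_ *: _).
(* [Phi] supplies a second formula for the same bracket; as [phi] is injective, comparison yields a
   linear relation between v and h. *)
have := PhiB v h; rewrite vh linearZ_LR /= Phih Phiv sl_bracketDl !sl_bracketZl.
rewrite sl_bracketxx scaler0 addr0 E scalerDr !scalerA => /eqP.
rewrite -subr_eq0 addrAC -scalerBl -!(linearZ_LR phi) -linearD /=.
rewrite -[0](linear0 phi) => /eqP/phi_injective.
(* Bracketing with h removes the h term and leaves a multiple of v, so c = 0 or the two eigenvalues
   coincide. *)
move/(congr1 (fun x => sl_bracket x h)).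
rewrite sl_bracketDl !sl_bracketZl sl_bracketxx vh scaler0 addr0 scalerA.
rewrite sl_bracket0l => /eqP.
rewrite scaler_eq0 (negPf v0) orbF mulf_eq0 => /orP[|/eqP->]; last by rewrite mulr0.
rewrite (mulrC c) -mulrBr mulf_eq0 (negPf a0) /= subr_eq0 => /eqP <-.
by [].
Qed.

(** Since [tau] is bijective, eigenvectors of [rho h] correspond to ad-eigenvectors of h. *)
Lemma local_eigen_adjoint_type h c v :
  v *m rho h = c *: v -> psi v *m rho (phi h) = c *: psi v.
Proof.
have [g <-] := equivariant_surj rho_irr _ tau_equivariant tau_neq0 v.
rewrite -tau_equivariant -(linearZ_LR tau) => /tau_inj gh.
have [b _ bE] := adjoint_type_psi.
rewrite !bE -scalemxAl -tau_equivariant (adjoint_type_bracket _ _ _ gh).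
by rewrite (linearZ_LR tau) !scalerA mulrC.
Qed.

End AdjointType.

Lemma local_automorphism : is_automorphism rho Delta.
Proof.
(* Excluded middle decides whether Hom(sl_n, I) is nonzero. *)
have [[tau [tauE tau0]]|no_hom] := classic (exists tau : {linear sl F n -> 'rV[F]_d},
    equivariant (rho := rho) tau /\ exists g, tau g <> 0).
  have [t tE] := adjoint_type_theta tauE tau0.
  apply: (local_automorphism_eigen (t \*: tau)) => // [h c v _|g h /=].
    exact: (local_eigen_adjoint_type tauE tau0).
  by rewrite tauE scalemxAl.
(* A nonzero [mix_part] would untwist to a nonzero element of Hom(sl_n, I). *)
have no_mix Phi : is_automorphism rho Phi -> forall g, mix_part Phi g = 0.
  move=> aut g; have [_ mixE _] := automorphism_parts rho_irr rho_nontrivial _ aut.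
  have [e eE ->] := twisted_equivariant rho_irr rho_nontrivial _ _ aut mixE.
  apply: NNPP => eg; case: no_hom; exists e; split=> //.
  by exists (sl_part Phi g).
apply: (local_automorphism_eigen \0) => [h c v _|g h|g] /=.
- exact: local_eigen_no_mix.
- by rewrite mul0mx.
- exact: local_theta_eq0.
Qed.

End LocalAutomorphism.

Theorem theorem3p1 (F : numClosedFieldType) (n d : nat) (rho : sl F n -> 'M[F]_d)
  (hn : (2 <= n)%N)
  (hmod : right_module rho) (hirr : irreducible_module rho)
  (hnt : nontrivial_action rho)
  (Delta : Lalg F n d -> Lalg F n d) (hlin : linear Delta) :
  is_local_automorphism rho Delta <-> is_automorphism rho Delta.
Proof.
split=> [[_ loc]|aut]; last by split=> // x; exists Delta.
have [rhoL rhoB] := hmod.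
pose rho' : {linear sl F n -> 'M[F]_d} :=
  HB.pack rho (GRing.isLinear.Build _ _ _ _ _ rhoL).
pose Delta' : {linear Lalg F n d -> Lalg F n d} :=
  HB.pack Delta (GRing.isLinear.Build _ _ _ _ _ hlin).
apply: (@local_automorphism F n d rho' rhoB hirr hnt Delta') => x.
have [Phi [aut PhiE]] := loc x; have [PhiL _ _] := aut.
pose Phi' : {linear Lalg F n d -> Lalg F n d} :=
  HB.pack Phi (GRing.isLinear.Build _ _ _ _ _ PhiL).
by exists Phi'.
Qed.
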